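(* For every tree $T$ with at least $3$ vertices, \[\gamma_P(T)\ge\left\lceil\frac{|V(T)|}{(\operatorname{diam}(T)-1)\cdot\Delta(T)+1}\right\rceil.\]
   Context: All graphs are finite, simple and undirected. $N(v)$ denotes the set of neighbors of a vertex $v$, and $N(S)=\bigcup_{v\in S}N(v)$. $\Delta(G)$ is the maximum degree of $G$ and $\operatorname{diam}(G)$ is the maximum distance between two vertices of $G$. For a set $S$ of vertices in a graph $G$, define $S^{[1]}=S\cup N(S)$ and, for $i\ge 1$, $S^{[i+1]}=S^{[i]}\cup\{w : \exists v\in S^{[i]},\ N(v)\cap (V(G)\setminus S^{[i]})=\{w\}\}$. The set $S$ is a power dominating set of $G$ if $S^{[\ell]}=V(G)$ for some positive integer $\ell$. The power domination number $\gamma_P(G)$ is the minimum cardinality of a power dominating set of $G$. *)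

(* Defs.v *)
From mathcomp Require Import all_boot all_order all_algebra.
From mathcomp Require Import boolp.

Set Implicit Arguments.
Unset Strict Implicit.
Unset Printing Implicit Defensive.

(* A finite graph is an edge relation [e] on a finite type [V] of vertices. *)

Definition simple_graph (V : finType) (e : rel V) : Prop :=
  symmetric e /\ irreflexive e.

Definition connected (V : finType) (e : rel V) : Prop :=
  forall x y : V, connect e x y.

(* In a simple graph, two adjacent vertices form a [ucycle] of size 2, so a
   graph-theoretic cycle is a [ucycle] of size at least 3. *)
Definition acyclic (V : finType) (e : rel V) : Prop :=
  forall c : seq V, 2 < size c -> ~ ucycle e c.

Definition tree (V : finType) (e : rel V) : Prop :=
  [/\ simple_graph e, 0 < #|V|, connected e & acyclic e].

Definition nbhd (V : finType) (e : rel V) (v : V) : {set V} := [set w | e v w].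

Definition nbhds (V : finType) (e : rel V) (S : {set V}) : {set V} :=
  \bigcup_(v in S) nbhd e v.

Definition max_degree (V : finType) (e : rel V) : nat :=
  \max_(v : V) #|nbhd e v|.

(* Shortest walks have fewer than #|V| edges; the value is #|V| when [y] cannot
   be reached from [x]. *)
Definition dist (V : finType) (e : rel V) (x y : V) : nat :=
  \big[minn/#|V|]_(n < #|V| |
      [exists p : n.-tuple V, path e x p && (last x p == y)]) n.

Definition diam (V : finType) (e : rel V) : nat :=
  \max_(x : V) \max_(y : V) dist e x y.

Definition propagate (V : finType) (e : rel V) (A : {set V}) : {set V} :=
  A :|: [set w | [exists v in A, nbhd e v :&: ~: A == [set w]]].

(* S^{[i]}, meaningful for i >= 1: S^{[1]} = S :|: N(S). *)
Definition monitored (V : finType) (e : rel V) (S : {set V}) (i : nat)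
    : {set V} :=
  iter i.-1 (propagate e) (S :|: nbhds e S).

Definition power_dominating (V : finType) (e : rel V) (S : {set V}) : Prop :=
  exists l : nat, 0 < l /\ monitored e S l = [set: V].

(* The whole vertex set is power dominating, so the minimum is attained. *)
Lemma power_dominatingT (V : finType) (e : rel V) :
  power_dominating e [set: V].
Proof. by exists 1; split=> //; rewrite /monitored /= setTU. Qed.

Definition power_domination_number (V : finType) (e : rel V) : nat :=
  #|[arg min_(S < [set: V] | `[< power_dominating e S >]) #|S| ]|.

(* Main.v *)
Require Import Defs.
From mathcomp Require Import all_boot all_order all_algebra.
From mathcomp Require Import boolp.

Set Implicit Arguments.
Unset Strict Implicit.
Unset Printing Implicit Defensive.

(** The bound holds for every power dominating set [S], not only for a smallest
one: [#|V| <= #|S| * ((diam e).-1 * max_degree e).+1].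

Record, for each vertex [w] outside [S], a parent [f w]: a neighbour of [w] in
[S] if there is one, and otherwise a vertex that forced [w] to become monitored.
A vertex forces at most one other vertex, so in this forest ([forcing_forest])
branching occurs only at the roots, which are the elements of [S].  Hence [w] is
determined by the branch on which it lies, that is, by the child of the root at
which that branch starts, and by its depth on the branch.  A root [s] has at
most [#|nbhd e s|] branches, and everything reduces to bounding their lengths.

A branch together with its root is a simple path, and in a tree a simple path is
a geodesic ([size_upath_diam]), so it has at most [diam e] edges.  If [s] has
degree at least 2, a neighbour of [s] off the branch prolongs the path
at the root end, so that the branch has at most [diam e - 1] vertices, and the
branches at [s] contain at most [(diam e - 1) * max_degree e] vertices in total.
If [s] is a leaf it has a single branch, of at most [diam e] vertices, and
[diam e <= (diam e - 1) * max_degree e] because the diameter and the maximum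
degree of a tree with at least three vertices are at least 2. *)

(** * Simple paths in trees *)

(** Two simple paths that part at [x] and meet again would close a cycle through
[x]: this is where acyclicity enters. *)
Lemma acyclic_upath_inj (V : finType) (e : rel V) (x : V) (p q : seq V) :
  symmetric e -> acyclic e ->
  path e x p -> path e x q -> uniq (x :: p) -> uniq (x :: q) ->
  last x p = last x q -> p = q.
Proof.
move=> symE acE; elim: p x q => [|a p IHp] x [|b q] //.
- by move=> _ _ _ /= /andP[xq _] xE; rewrite xE mem_last in xq.
- by move=> _ _ /= /andP[xp _] _ xE; rewrite -xE mem_last in xp.
move=> /= /andP[exa pa] /andP[exb qb] /andP[xp Up] /andP[xq Uq] lastE.
have [abE|neq_ab] := eqVneq a b.
  by rewrite -abE in qb Uq lastE *; congr cons; apply: (IHp a).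
(* The walk [r] goes from [a] along [p] to the common end, then back along [q]
   to [b]; it avoids [x]. *)
pose r := p ++ rev (belast b q).
have rP : path e a r.
  rewrite cat_path pa lastE rev_path.
  by rewrite (eq_path (e' := e)) // => u v; rewrite symE.
have lastr : last a r = b.
  rewrite last_cat; case: (q) lastE => [|c q'] //=.
  by rewrite rev_cons last_rcons.
have xr : x \notin a :: r.
  rewrite -cat_cons mem_cat negb_or xp mem_rev /=.
  by apply: contra xq => /mem_belast.
case: (shortenP rP) lastr => r' r'P Ur' sub lastr'.
have xr' : x \notin a :: r'.
  apply: contra xr; rewrite !inE => /orP[->//|/sub ->]; exact: orbT.
case: r' r'P Ur' lastr' xr' {sub} => [|c r'] r'P Ur' lastr' xr'.
  by rewrite -lastr' eqxx in neq_ab.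
exfalso; apply: (acE (x :: a :: c :: r')) => //.
rewrite /ucycle cons_uniq xr' Ur' andbT.
rewrite /cycle rcons_path [last _ _]lastr' symE exb andbT.
by rewrite andbT [path _ _ _]/= exa.
Qed.

Lemma size_upath_lt_card (V : finType) (x : V) (p : seq V) :
  uniq (x :: p) -> size p < #|V|.
Proof.
by move=> Up; rewrite -[(size p).+1]/(size (x :: p)) -(card_uniqP Up) max_card.
Qed.

(** Any walk contains a simple path with the same ends, which in a tree is the
given one: simple paths are shortest walks. *)
Lemma size_upath_dist (V : finType) (e : rel V) (x : V) (p : seq V) :
  symmetric e -> acyclic e -> path e x p -> uniq (x :: p) ->
  size p <= dist e x (last x p).
Proof.
move=> symE acE pP Up; rewrite /dist.
elim/big_ind: _ => [|m n lem len|i /existsP[q /andP[qP /eqP lastq]]].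
- exact/ltnW/size_upath_lt_card/Up.
- by rewrite leq_min lem len.
rewrite -(size_tuple q); case: (shortenP qP) lastq => q' q'P Uq' sub lastq'.
rewrite (acyclic_upath_inj symE acE pP q'P) //.
by apply: uniq_leq_size; [case/andP: Uq' | exact: sub].
Qed.

Lemma size_upath_diam (V : finType) (e : rel V) (x : V) (p : seq V) :
  symmetric e -> acyclic e -> path e x p -> uniq (x :: p) -> size p <= diam e.
Proof.
move=> symE acE pP Up; apply: leq_trans (size_upath_dist symE acE pP Up) _.
apply: leq_trans (leq_bigmax x).
exact: (leq_bigmax (F := fun y => dist e x y)).
Qed.

(** A second neighbour of [x] cannot lie on the path, since the edge to it would
be a competing simple path; so it prolongs the path beyond [x]. *)
Lemma size_upath_deg_ge2 (V : finType) (e : rel V) (x y : V) (p : seq V) :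
  symmetric e -> irreflexive e -> acyclic e ->
  path e x (y :: p) -> uniq [:: x, y & p] -> 2 <= #|nbhd e x| ->
  (size p).+2 <= diam e.
Proof.
move=> symE irrE acE pP Up /card_gt1P[a [b [xa xb neq_ab]]].
have [z exz neq_zy] : exists2 z, e x z & z != y.
  have [aE|] := eqVneq a y; last by exists a => //; rewrite inE in xa.
  by exists b; [rewrite inE in xb | rewrite -aE eq_sym].
have neq_xz : x != z by apply: contraTneq exz => <-; rewrite irrE.
have zp : z \notin y :: p.
  apply/negP => zp; have [p1 [p2 pE]] : exists p1 p2, y :: p = rcons p1 z ++ p2.
    by case/path.splitP: zp => p1 p2; exists p1, p2.
  move: pP Up; rewrite pE cat_path -cat_cons cat_uniq.
  move=> /andP[p1P _] /andP[Up1 _].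
  have p1E : rcons p1 z = [:: z].
    apply: (acyclic_upath_inj symE acE p1P) => //; rewrite ?last_rcons //=.
      by rewrite exz.
    by rewrite inE neq_xz.
  by rewrite p1E in pE; case: pE neq_zy => ->; rewrite eqxx.
apply: (size_upath_diam (x := z) (p := [:: x, y & p]) symE acE).
  by rewrite /= symE exz.
by rewrite cons_uniq Up andbT inE negb_or eq_sym neq_xz.
Qed.

(** If [x] has degree at most 1, some vertex is neither [x] nor a neighbour of
[x], and the first inner vertex on a simple path from [x] to it has degree at
least 2. *)
Lemma exists_deg_ge2 (V : finType) (e : rel V) :
  symmetric e -> connected e -> 3 <= #|V| -> exists v, 2 <= #|nbhd e v|.
Proof.
move=> symE conE V3.
have /card_gt0P[x _] : 0 < #|V| by apply: leq_trans V3.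
have [|deg_x] := leqP 2 #|nbhd e x|; first by exists x.
have [y] : exists y, y \notin x |: nbhd e x.
  apply/existsP; rewrite -[X in is_true X]negbK negb_exists.
  apply/negP => /forallP all_in.
  have : #|V| <= #|x |: nbhd e x|.
    by apply/subset_leq_card/subsetP => y _; rewrite -[_ \in _]negbK.
  rewrite cardsU1 leqNgt => /negP; apply; apply: leq_ltn_trans V3.
  by rewrite (leq_add (leq_b1 _)).
rewrite !inE negb_or => /andP[neq_yx nexy].
case/connectP: (conE x y) => q qP yE.
case: (shortenP qP) yE => -[|a [|b p]] pP Up _ yE.
- by rewrite yE eqxx in neq_yx.
- by rewrite yE in nexy; rewrite /= in pP nexy; case/andP: pP nexy => ->.
exists a; apply/card_gt1P; exists x, b.
case/and3P: pP => exa eab _; rewrite !inE symE exa eab; split=> //.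
by apply: contraTneq Up => ->; rewrite /= !inE eqxx !orbT.
Qed.

Lemma diam_ge2 (V : finType) (e : rel V) (v : V) :
  symmetric e -> irreflexive e -> acyclic e -> 2 <= #|nbhd e v| -> 2 <= diam e.
Proof.
move=> symE irrE acE deg_v.
have /card_gt1P[y [_ [yv _ _]]] := deg_v; rewrite inE in yv.
apply: (size_upath_deg_ge2 symE irrE acE (x := v) (y := y) (p := [::])) => //=.
  by rewrite yv.
by rewrite inE andbT; apply: contraTneq yv => <-; rewrite irrE.
Qed.

(** * The forcing forest *)

Lemma iter_propagate_sub (V : finType) (e : rel V) (A : {set V}) (i j : nat) :
  i <= j -> iter i (propagate e) A \subset iter j (propagate e) A.
Proof.
move=> /subnKC <-; elim: (j - i) => [|k IHk]; first by rewrite addn0.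
by rewrite addnS /=; apply: subset_trans IHk (subsetUl _ _).
Qed.

(** [t w] is the step at which [w] becomes monitored, with value 0 on [S].  The
injectivity of [f] expresses that a vertex forces at most one other vertex: of
two vertices forced by [v], the one forced later would be a second unmonitored
neighbour of [v] when the first is forced.  Vertices of [S] are exempt, since
they monitor all their neighbours at once. *)
Lemma forcing_forest (V : finType) (e : rel V) (S : {set V}) :
  power_dominating e S ->
  exists (f : V -> V) (t : V -> nat),
    (forall w, w \notin S -> e (f w) w /\ t (f w) < t w) /\
    (forall w w', w \notin S -> w' \notin S -> f w = f w' -> f w \notin S ->
       w = w').
Proof.
case=> l [_ domS]; pose B i := iter i (propagate e) (S :|: nbhds e S).
have inB w : exists i, w \in B i by exists l.-1; rewrite [B _]domS inE.
pose tB w := ex_minn (inB w).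
pose t w := if w \in S then 0 else (tB w).+1.
have tB_le w i : w \in B i -> tB w <= i.
  by rewrite /tB; case: ex_minnP => m _ minm; apply: minm.
have par w : exists v, w \notin S ->
    [/\ e v w, t v < t w &
        v \notin S -> exists i, nbhd e v :&: ~: B i = [set w]].
  have [wS|wNS] := boolP (w \in S); first by exists w.
  have tw : t w = (tB w).+1 by rewrite /t (negbTE wNS).
  have tB_w : w \in B (tB w) by rewrite /tB; case: ex_minnP.
  case tBE : (tB w) tB_w => [|i] w_in.
    move: w_in; rewrite /B /= in_setU (negbTE wNS) => /bigcupP[v vS].
    by rewrite inE => evw; exists v => _; rewrite tw /t vS; split.
  have wNB : w \notin B i by apply/negP => /tB_le; rewrite tBE ltnn.
  move: w_in; rewrite [B _]/= in_setU (negbTE wNB) /= inE.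
  case/existsP => v /andP[vB /eqP nbE]; exists v => _; split.
  - by have /setIP[] : w \in nbhd e v :&: ~: B i; rewrite ?nbE ?inE.
  - by rewrite tw /t; case: ifP => // _; rewrite ltnS tBE ltnS tB_le.
  - by exists i.
have [f fP] := choice par; exists f, t; split=> [w wNS|w w' wNS w'NS fE fNS].
  by have [] := fP w wNS.
have [_ _ /(_ fNS)[i iE]] := fP w wNS.
have [_ _] := fP w' w'NS; rewrite -fE => /(_ fNS)[j jE].
wlog le_ij : w w' i j wNS w'NS fE fNS iE jE / i <= j.
  move=> IH; case: (leqP i j) => [|/ltnW] le; first exact: (IH w w' i j).
  by apply/esym; apply: (IH w' w j i) => //; rewrite -?fE.
apply/esym/set1P; rewrite -iE.
have : w' \in nbhd e (f w) :&: ~: B j by rewrite jE set11.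
rewrite !inE => /andP[-> /=]; apply: contra.
exact/subsetP/iter_propagate_sub.
Qed.

(** * Branches *)

(** Descending segments of the branches of the forest [f].  A segment starts a
branch exactly when [f n], which is not listed, lies in [S] and so is the root
of that branch. *)
Definition branch (V : finType) (S : {set V}) (f : V -> V)
    (n : V) (p : seq V) :=
  path (fun a b => f b == a) n p && all [predC S] (n :: p).

(** Ranks decrease along parents, so the ascent from [w] ends in [S]. *)
Lemma branch_exists (V : finType) (S : {set V}) (f : V -> V) (t : V -> nat)
    (w : V) :
  (forall w, w \notin S -> t (f w) < t w) -> w \notin S ->
  exists n p, [/\ branch S f n p, f n \in S & last n p = w].
Proof.
move=> t_lt; elim: {w}(t w).+1 {-2}w (ltnSn (t w)) => // k IHk w le_k wNS.
have [fS|fNS] := boolP (f w \in S).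
  by exists w, [::]; rewrite /branch /= wNS.
have [|n [p [/andP[pP pS] nS lastE]]] := IHk (f w) _ fNS.
  by apply: leq_trans (t_lt w wNS) _.
exists n, (rcons p w); rewrite last_rcons; split=> //.
by rewrite /branch rcons_path pP lastE eqxx -rcons_cons all_rcons pS /= wNS.
Qed.

(** Descending from [n], there is never a choice: outside [S] each vertex has at
most one child. *)
Lemma branch_inj (V : finType) (S : {set V}) (f : V -> V) (n : V)
    (p q : seq V) :
  (forall w w', w \notin S -> w' \notin S -> f w = f w' -> f w \notin S ->
     w = w') ->
  branch S f n p -> branch S f n q -> size p = size q -> p = q.
Proof.
move=> f_inj; elim: p q n => [|a p IHp] [|b q] n //.
move=> /andP[/= /andP[/eqP fa pP] /and3P[nNS aNS pS]].
move=> /andP[/= /andP[/eqP fb qP] /and3P[_ bNS qS]] [szE].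
have abE : a = b by apply: f_inj; rewrite ?fa ?fb.
rewrite -abE in qP bNS *.
by congr cons; apply: (IHp _ a); rewrite // /branch ?pP ?qP /= aNS ?pS ?qS.
Qed.

(** Ranks increase strictly from a parent to its child, so a descending path
never returns to a vertex. *)
Lemma branch_upath (V : finType) (e : rel V) (S : {set V}) (f : V -> V)
    (t : V -> nat) (n : V) (p : seq V) :
  (forall w, w \notin S -> e (f w) w /\ t (f w) < t w) ->
  branch S f n p -> path e (f n) (n :: p) /\ uniq [:: f n, n & p].
Proof.
move=> fP /andP[pP pS].
have fpP : path (fun a b => f b == a) (f n) (n :: p) by rewrite /= eqxx.
have sub (r : rel V) :
    (forall w, w \notin S -> r (f w) w) -> path r (f n) (n :: p).
  move=> rP; elim: (n :: p) (f n) fpP pS => //= b q IHq a.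
  by move=> /andP[/eqP <- qP] /andP[bNS qS]; rewrite rP //= IHq.
split; first by apply: sub => w /fP[].
apply: (sorted_uniq (leT := fun a b => t a < t b)) => [b a c||].
- exact: ltn_trans.
- by move=> a; exact: ltnn.
- by apply: sub => w /fP[].
Qed.

(** * Counting *)

(** The bound on the number of vertices of a branch with root [s].  A leaf has no
second neighbour with which to prolong the branch, so its bound is larger by
one; [branch_bound_degree] absorbs this since it has only one branch. *)
Definition branch_bound (V : finType) (e : rel V) (s : V) :=
  if 2 <= #|nbhd e s| then (diam e).-1 else diam e.

Lemma size_branch (V : finType) (e : rel V) (S : {set V}) (f : V -> V)
    (t : V -> nat) (n : V) (p : seq V) :
  symmetric e -> irreflexive e -> acyclic e ->
  (forall w, w \notin S -> e (f w) w /\ t (f w) < t w) ->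
  branch S f n p -> size p < branch_bound e (f n).
Proof.
move=> symE irrE acE fP pB; have [pP Up] := branch_upath fP pB.
rewrite /branch_bound; case: ifP => [deg|_].
  by rewrite ltn_predRL; exact: (size_upath_deg_ge2 symE irrE acE pP Up deg).
exact: (size_upath_diam symE acE pP Up).
Qed.

Lemma branch_bound_degree (V : finType) (e : rel V) (s : V) :
  2 <= diam e -> 2 <= max_degree e ->
  #|nbhd e s| * branch_bound e s <= (diam e).-1 * max_degree e.
Proof.
move=> diam2 deg2; rewrite mulnC /branch_bound; case: ltnP => [_|deg1].
  by rewrite leq_mul2l (leq_bigmax (F := fun v => #|nbhd e v|)) orbT.
apply: (@leq_trans ((diam e).-1 * 2)); last by rewrite leq_mul2l deg2 orbT.
rewrite (leq_trans (leq_mul (leqnn _) deg1)) //.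
case: (diam e) diam2 => [|[|d]] //= _.
by rewrite muln1 muln2 -addnn addnS !ltnS leq_addr.
Qed.

(** The vertices outside [S] are sorted by the root of their branch.  For a given
root, a vertex is encoded by the first vertex of its branch and its depth on the
branch, which determine it by [branch_inj]. *)
Lemma power_dominating_card (V : finType) (e : rel V) (S : {set V}) :
  tree e -> 3 <= #|V| -> power_dominating e S ->
  #|V| <= #|S| * ((diam e).-1 * max_degree e).+1.
Proof.
case=> -[symE irrE] _ conE acE V3 /forcing_forest[f [t [fP f_inj]]].
have [v deg_v] := exists_deg_ge2 symE conE V3.
have diam2 := diam_ge2 symE irrE acE deg_v.
have deg2 : 2 <= max_degree e.
  by apply: leq_trans deg_v (leq_bigmax (F := fun v => #|nbhd e v|) v).
have /choice[c cP] : forall w, exists np : V * seq V, w \notin S ->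
    [/\ branch S f np.1 np.2, f np.1 \in S & last np.1 np.2 = w].
  move=> w; have [_|wNS] := boolP (w \in S); first by exists (w, [::]).
  have t_lt u : u \notin S -> t (f u) < t u by case/fP.
  by have [n [p npP]] := branch_exists t_lt wNS; exists (n, p).
pose code w := ((c w).1, inord (size (c w).2) : 'I_(diam e).+1).
have size_c w : w \notin S -> size (c w).2 < branch_bound e (f (c w).1).
  by case/cP => cB _ _; exact: size_branch symE irrE acE fP cB.
have bound_le s : branch_bound e s <= diam e.
  by rewrite /branch_bound; case: ifP; rewrite ?leq_pred.
have size_le w : w \notin S -> size (c w).2 < (diam e).+1.
  by move=> /size_c lt; rewrite ltnS; apply/ltnW/(leq_trans lt)/bound_le.
pose fibre s := [set w | (w \notin S) && (f (c w).1 == s)].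
have fibre_le s : #|fibre s| <= (diam e).-1 * max_degree e.
  apply: leq_trans (branch_bound_degree s diam2 deg2).
  rewrite -(card_in_imset (f := code)); last first.
    move=> w w'; rewrite !inE => /andP[wNS _] /andP[w'NS _] [nE /(congr1 val)].
    rewrite /= !inordK ?size_le // => szE.
    have [cB _ <-] := cP w wNS; have [cB' _ <-] := cP w' w'NS.
    by rewrite -nE in cB' *; rewrite (branch_inj f_inj cB cB' szE).
  pose depths := [set k : 'I_(diam e).+1 | k < branch_bound e s].
  apply: (@leq_trans #|setX (nbhd e s) depths|).
    apply/subset_leq_card/subsetP => _ /imsetP[w + ->].
    rewrite !inE => /andP[wNS /eqP <-] /=.
    rewrite inordK ?size_le // size_c // andbT.
    by have [/andP[_ /andP[/fP[]]]] := cP w wNS.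
  rewrite cardsX leq_mul2l; apply/orP; right.
  rewrite -sum1_card; under eq_bigl do rewrite inE.
  rewrite (big_ord_narrow (leqW (bound_le s))).
  by rewrite sum1_card card_ord.
rewrite -(cardsC S) mulnS leq_add2l.
have -> : #|~: S| = \sum_(s in S) #|fibre s|.
  rewrite -sum1_card (partition_big (fun w => f (c w).1) [in S]) /=.
    apply: eq_bigr => s _; rewrite -sum1_card.
    by apply: eq_bigl => w; rewrite !inE.
  by move=> w; rewrite inE => /cP[].
by rewrite -sum_nat_const leq_sum.
Qed.

Theorem corollary2p6 (V : finType) (e : rel V) (treeV : tree e)
    (V_ge3 : (3 <= #|V|)%N) :
  (Num.ceil (#|V|%:R / (((diam e)%:R - 1) * (max_degree e)%:R + 1) : rat)
     <= (power_domination_number e)%:Z)%R.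
Proof.
rewrite /power_domination_number.
case: arg_minnP => [|S /asboolP domS _]; first exact/asboolP/power_dominatingT.
have le_card := power_dominating_card treeV V_ge3 domS.
have diam_gt0 : (0 < diam e)%N.
  have [[symE irrE] _ conE acE] := treeV.
  have [v /(diam_ge2 symE irrE acE)] := exists_deg_ge2 symE conE V_ge3.
  exact: ltnW.
have denE : (((diam e)%:R - 1) * (max_degree e)%:R + 1 : rat)%R
    = ((diam e).-1 * max_degree e).+1%:R%R.
  rewrite -{1}(prednK diam_gt0) -GRing.natr1 GRing.addrK.
  by rewrite -GRing.natr1 GRing.natrM.
rewrite Num.Theory.ceil_le_int denE.
rewrite Num.Theory.ler_pdivrMr ?Num.Theory.ltr0Sn //.
by rewrite -GRing.natrM Num.Theory.ler_nat.
Qed.
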